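(* Assume the standing setting and hypothesis (H) below, and let $y_f\in[0,1]^M$. Let $y\in S$ with $\varepsilon$-representative $z\in\mathcal{X}$, let $\pi^\varepsilon_k=\pi^\varepsilon_k(z)$ be the approximate optimal pattern of length $k$ associated to $z$, and let $\mathbf{v}_k(y)=\min_{\pi\in U^k}\|Y^\pi_{k\tau,y}-y_f\|$. Then, with $T=k\tau$, the error $$E_\varepsilon(T):=\Big|\,\|\tilde Y^{\pi^\varepsilon_k}_{k\tau,z}-y_f\|-\mathbf{v}_k(y)\Big|$$ satisfies $E_\varepsilon(T)\le(2k+1)\varepsilon$.
   Context: Setting. Fix integers $M,k\ge1$, reals $L>0$, $\sigma>0$, $\tau>0$, $\varepsilon>0$; $h=L/(M+1)$, $S=[0,1]^M$, Euclidean norm $\|\cdot\|$ and inner product $\langle\cdot,\cdot\rangle$. $\mathcal{L}_h=\frac1{h^2}\mathrm{tridiag}(1,-2,1)$ ($M\times M$). $U\subset[0,1]^2$ is a finite set of modes; for $u=(u_0,u_L)$, $\varphi_h(u)=\frac1{h^2}(u_0,0,\dots,0,u_L)^\top$. A map $f:\mathbb{R}^M\to\mathbb{R}^M$ is given and $f_u(y)=\sigma\mathcal{L}_hy+\sigma\varphi_h(u)+f(y)$, assumed Lipschitz on $S$ with constant $L_u$. $\lambda_u$ is the OSL constant of $f_u$ on $S$ (smallest constant with $\langle f_u(y_1)-f_u(y_2),y_1-y_2\rangle\le\lambda_u\|y_1-y_2\|^2$ for all $y_1,y_2\in S$), and $C_u=\sup_{y\in S}L_u\|f_u(y)\|$.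 Trajectories. For a pattern $\pi=u_k\cdots u_1\in U^k$ and $y\in S$, $Y^\pi_{t,y}$ ($t\in[0,k\tau]$) is the continuous solution of $dy/dt=f_{u_k}(y)$ on $[0,\tau)$ with $Y^\pi_{0,y}=y$, continued by the solution of $dy/dt=f_{u_{k-1}}(y)$ on $[\tau,2\tau)$, and so on up to $f_{u_1}$ on $[(k-1)\tau,k\tau]$. The Euler image is $\tilde Y^u_{t,z}=z+tf_u(z)$ for $t\in[0,\tau]$, and $\tilde Y^\pi_{t,z}=\tilde Y^{u_k}_{t,z}$ for $t\in[0,\tau]$, $\tilde Y^{\pi}_{t,z}=\tilde Y^{u_{k-1}\cdots u_1}_{t-\tau,\tilde Y^{u_k}_{\tau,z}}$ for $t\in[\tau,k\tau]$. It is assumed that all these exact and Euler trajectories remain in $S$. Grid. $K$ is an integer with $K\ge\sqrt{M}/(2\varepsilon)$; $[0,1]$ is split into $K$ equal subintervals, hence $S$ into $K^M$ equal cubic cells; $\mathcal{X}$ is the set of cell centers. The $\varepsilon$-representative of $y\in S$ is the center of a (fixed choice of) cell containing $y$, so $\|y-z\|\le\varepsilon$. Hypothesis (H). For each $u\in U$ let $G_u=\sqrt3\,\varepsilon|\lambda_u|/C_u$ and $\alpha_u=1+\frac{|\lambda_u|G_u}{4}-\sqrt{1+(\lambda_uG_u/4)^2}$. (H) requires, for all $u\in U$: $\lambda_u<0$, $\frac{|\lambda_u|G_u}{4}<1$, and $\tau\le G_u(1-\alpha_u)$. Discrete dynamic programming. For $u\in U$ and $z\in\mathcal{X}$, $next^u(z)$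 is the $\varepsilon$-representative of $z+\tau f_u(z)$. $\mathbf{v}^\varepsilon_0(z)=\|z-y_f\|$ and $\mathbf{v}^\varepsilon_j(z)=\min_{u\in U}\mathbf{v}^\varepsilon_{j-1}(next^u(z))$ for $j\ge1$. $\pi^\varepsilon_0(z)=$ empty word and, for $j\ge1$, $\pi^\varepsilon_j(z)=\mathbf{u}_j(z)\cdot\pi^\varepsilon_{j-1}(next^{\mathbf{u}_j(z)}(z))$ with $\mathbf{u}_j(z)\in\arg\min_{u\in U}\mathbf{v}^\varepsilon_{j-1}(next^u(z))$ (ties broken by a fixed rule); the first letter of a pattern is the mode applied first. *)

(* Defs.v *)
From Stdlib Require Import Reals List Arith.
Import ListNotations.
Open Scope R_scope.

(* Vectors of R^M are represented as functions nat -> R; only indices i < M matter. *)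
Definition vec := nat -> R.

Fixpoint sumn (n : nat) (g : nat -> R) : R :=
  match n with O => 0 | S n' => sumn n' g + g n' end.

Definition ip (M : nat) (x y : vec) : R := sumn M (fun i => x i * y i).
Definition vnorm (M : nat) (x : vec) : R := sqrt (ip M x x).
Definition vadd (x y : vec) : vec := fun i => x i + y i.
Definition vsub (x y : vec) : vec := fun i => x i - y i.
Definition vscal (a : R) (x : vec) : vec := fun i => a * x i.

Definition inS (M : nat) (y : vec) : Prop := forall i, (i < M)%nat -> 0 <= y i <= 1.

(* a mode u = (u_0, u_L) *)
Definition mode := (R * R)%type.

Definition hstep (L : R) (M : nat) : R := L / INR (M + 1).

(* L_h = (1/h^2) tridiag(1,-2,1), with zero values outside indices 0..M-1 *)
Definition lapl (M : nat) (h : R) (y : vec) : vec := fun i =>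
  ((if Nat.eqb i 0 then 0 else y (i - 1)%nat) - 2 * y i
   + (if Nat.ltb (i + 1) M then y (i + 1)%nat else 0)) / h ^ 2.

Definition phih (M : nat) (h : R) (u : mode) : vec := fun i =>
  ((if Nat.eqb i 0 then fst u else 0) + (if Nat.eqb i (M - 1) then snd u else 0)) / h ^ 2.

Definition fmode (M : nat) (L sigma : R) (f : vec -> vec) (u : mode) (y : vec) : vec :=
  fun i => sigma * lapl M (hstep L M) y i + sigma * phih M (hstep L M) u i + f y i.

Definition lipschitz_on_S (M : nat) (g : vec -> vec) (Lc : R) : Prop :=
  forall y1 y2, inS M y1 -> inS M y2 ->
    vnorm M (vsub (g y1) (g y2)) <= Lc * vnorm M (vsub y1 y2).

Definition osl_on_S (M : nat) (g : vec -> vec) (c : R) : Prop :=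
  forall y1 y2, inS M y1 -> inS M y2 ->
    ip M (vsub (g y1) (g y2)) (vsub y1 y2) <= c * (vnorm M (vsub y1 y2)) ^ 2.

Definition is_osl_const (M : nat) (g : vec -> vec) (lam : R) : Prop :=
  osl_on_S M g lam /\ forall c, osl_on_S M g c -> lam <= c.

Definition Gconst (eps lam C : R) : R := sqrt 3 * eps * Rabs lam / C.
Definition alphaconst (eps lam C : R) : R :=
  1 + Rabs lam * Gconst eps lam C / 4 - sqrt (1 + (lam * Gconst eps lam C / 4) ^ 2).
Definition hypH (eps lam C tau : R) : Prop :=
  lam < 0 /\ Rabs lam * Gconst eps lam C / 4 < 1 /\
  tau <= Gconst eps lam C * (1 - alphaconst eps lam C).

Fixpoint euler (F : mode -> vec -> vec) (tau : R) (pi : list mode) (t : R) (z : vec) : vec :=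
  match pi with
  | nil => z
  | u :: r => if Rle_dec t tau then vadd z (vscal t (F u z))
              else euler F tau r (t - tau) (vadd z (vscal tau (F u z)))
  end.

Fixpoint patterns (U : list mode) (k : nat) : list (list mode) :=
  match k with
  | O => [nil]
  | S k' => flat_map (fun u => map (cons u) (patterns U k')) U
  end.

Fixpoint lmin (l : list R) : R :=
  match l with
  | nil => 0
  | x :: r => match r with nil => x | _ => Rmin x (lmin r) end
  end.

(* Grid: z is the center of one of the K^M cells *)
Definition is_center (M K : nat) (z : vec) : Prop :=
  forall i, (i < M)%nat -> exists j : nat, (j < K)%nat /\ z i = (2 * INR j + 1) / (2 * INR K).

(* rep is a (fixed) choice of eps-representative: the center of a cell containing y *)
Definition is_rep (M K : nat) (rep : vec -> vec) : Prop :=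
  forall y, inS M y -> is_center M K (rep y) /\
    forall i, (i < M)%nat -> Rabs (y i - rep y i) <= 1 / (2 * INR K).

Definition next (F : mode -> vec -> vec) (tau : R) (rep : vec -> vec) (u : mode) (z : vec) : vec :=
  rep (vadd z (vscal tau (F u z))).

Fixpoint vdp (M : nat) (F : mode -> vec -> vec) (tau : R) (rep : vec -> vec)
    (U : list mode) (yf : vec) (j : nat) (z : vec) : R :=
  match j with
  | O => vnorm M (vsub z yf)
  | S j' => lmin (map (fun u => vdp M F tau rep U yf j' (next F tau rep u z)) U)
  end.

(* sel j z = u_j(z): an argmin (fixed tie-breaking rule) on grid points *)
Definition is_sel (M K : nat) (F : mode -> vec -> vec) (tau : R) (rep : vec -> vec)
    (U : list mode) (yf : vec) (sel : nat -> vec -> mode) : Prop :=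
  forall j z, (1 <= j)%nat -> is_center M K z ->
    In (sel j z) U /\
    forall u, In u U ->
      vdp M F tau rep U yf (j - 1) (next F tau rep (sel j z) z)
      <= vdp M F tau rep U yf (j - 1) (next F tau rep u z).

Fixpoint pidp (F : mode -> vec -> vec) (tau : R) (rep : vec -> vec)
    (sel : nat -> vec -> mode) (j : nat) (z : vec) : list mode :=
  match j with
  | O => nil
  | S j' => sel j z :: pidp F tau rep sel j' (next F tau rep (sel j z) z)
  end.

Definition is_exact_traj (M : nat) (F : mode -> vec -> vec) (tau : R) (pi : list mode)
    (y : vec) (Y : R -> vec) : Prop :=
  (forall i, (i < M)%nat -> Y 0 i = y i) /\
  (forall i, (i < M)%nat -> forall t, 0 <= t <= INR (length pi) * tau ->
     forall e, e > 0 -> exists d, d > 0 /\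
       forall s, 0 <= s <= INR (length pi) * tau -> Rabs (s - t) < d ->
         Rabs (Y s i - Y t i) < e) /\
  (forall j, (j < length pi)%nat -> forall t, INR j * tau < t < INR (S j) * tau ->
     forall i, (i < M)%nat ->
       derivable_pt_lim (fun s => Y s i) t (F (nth j pi (0, 0)) (Y t) i)).

(* Main.v *)
(** All modes share the same one-sided Lipschitz constant [- m], since they differ only by
    a constant vector field. Writing [x = m tau] and [q = x (1 - x / 2)], hypothesis (H)
    gives [(tau C)^2 <= 3 eps^2 m^2 (1 - x / 2)], and then, in one time step:
    - exact flow against Euler step, from distance [d >= eps]: the squared distance becomes
      at most [d^2 - q (d^2 - eps^2)];
    - Euler step against Euler step, from distance [d]: at most [d^2 + 3/2 q eps^2], and
      no expansion beyond any bound [D >= 2 eps].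
    Each rounding to the grid adds [eps]. After [k >= 2] steps the Euler image is thus within
    [(k + 3/4 q) eps] of the grid trajectory of the same pattern, and the exact image within
    [(k + 1 - 3/4 q) eps] of its grid trajectory. The sum is [(2k + 1) eps], and optimality
    of [pidp] among grid trajectories gives the upper bound; the lower bound only needs
    the first estimate with [d = eps]. *)
Require Import Defs.
From Stdlib Require Import Reals List Arith Lra Lia.
From Coquelicot Require Import Coquelicot.
Import ListNotations.
Open Scope R_scope.

(** * Finite sums, inner product and Euclidean norm *)

Lemma sumn_ext (n : nat) (g h : nat -> R) :
  (forall i, (i < n)%nat -> g i = h i) -> sumn n g = sumn n h.
Proof.
  induction n as [|n IH]; intros H; simpl; [reflexivity|].
  rewrite IH, (H n); auto.
Qed.

Lemma sumn_lin (n : nat) (a b : R) (g h : nat -> R) :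
  sumn n (fun i => a * g i + b * h i) = a * sumn n g + b * sumn n h.
Proof. induction n as [|n IH]; simpl; [ring|rewrite IH; ring]. Qed.

Lemma sumn_le_const (n : nat) (c : R) (g : nat -> R) :
  (forall i, (i < n)%nat -> g i <= c) -> sumn n g <= INR n * c.
Proof.
  induction n as [|n IH]; intros H; [simpl; lra|].
  rewrite S_INR; simpl. assert (g n <= c) by auto.
  assert (sumn n g <= INR n * c) by auto. lra.
Qed.

Lemma ip_ext (M : nat) (x x' y y' : vec) :
  (forall i, (i < M)%nat -> x i = x' i) -> (forall i, (i < M)%nat -> y i = y' i) ->
  ip M x y = ip M x' y'.
Proof.
  intros Hx Hy. apply sumn_ext; intros i Hi. now rewrite Hx, Hy.
Qed.

Lemma ip_sym (M : nat) (x y : vec) : ip M x y = ip M y x.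
Proof. apply sumn_ext; intros; ring. Qed.

Lemma ip_lin_l (M : nat) (a b : R) (x y z : vec) :
  ip M (fun i => a * x i + b * y i) z = a * ip M x z + b * ip M y z.
Proof.
  unfold ip. rewrite <- sumn_lin. apply sumn_ext; intros; ring.
Qed.

Lemma ip_lin_sqr (M : nat) (a b : R) (x y : vec) :
  ip M (fun i => a * x i + b * y i) (fun i => a * x i + b * y i)
  = a ^ 2 * ip M x x + 2 * a * b * ip M x y + b ^ 2 * ip M y y.
Proof.
  rewrite ip_lin_l, !(ip_sym _ _ (fun i => a * x i + b * y i)), !ip_lin_l.
  rewrite (ip_sym M y x). ring.
Qed.

Lemma ip_pos (M : nat) (x : vec) : 0 <= ip M x x.
Proof.
  unfold ip. induction M as [|M IH]; simpl; [lra|].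
  pose proof (Rle_0_sqr (x M)) as H. unfold Rsqr in H. lra.
Qed.

Lemma vnorm_pos (M : nat) (x : vec) : 0 <= vnorm M x.
Proof. apply sqrt_pos. Qed.

Lemma vnorm_sqr (M : nat) (x : vec) : vnorm M x ^ 2 = ip M x x.
Proof. apply pow2_sqrt, ip_pos. Qed.

Lemma vnorm_ext (M : nat) (x y : vec) :
  (forall i, (i < M)%nat -> x i = y i) -> vnorm M x = vnorm M y.
Proof. intros H. unfold vnorm. f_equal. now apply ip_ext. Qed.

Lemma vnorm_le_sqr (M : nat) (x : vec) (c : R) :
  0 <= c -> ip M x x <= c ^ 2 -> vnorm M x <= c.
Proof.
  intros Hc H. rewrite <- vnorm_sqr in H. pose proof (vnorm_pos M x). nra.
Qed.

Lemma ip_le_sqr (M : nat) (x : vec) (c : R) : vnorm M x <= c -> ip M x x <= c ^ 2.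
Proof. intros H. rewrite <- vnorm_sqr. pose proof (vnorm_pos M x). nra. Qed.

(** With X, Y the two norms, the square of Y x - X y equals 2 X Y (X Y - <x, y>). Its nonnegativity
    settles the case X Y > 0; the case X Y = 0 is separate. *)
Lemma cauchy_schwarz (M : nat) (x y : vec) : ip M x y <= vnorm M x * vnorm M y.
Proof.
  pose proof (vnorm_sqr M x) as HX. pose proof (vnorm_sqr M y) as HY.
  pose proof (vnorm_pos M x). pose proof (vnorm_pos M y).
  set (X := vnorm M x) in *. set (Y := vnorm M y) in *.
  pose proof (ip_pos M (fun i => Y * x i + (- X) * y i)) as H1.
  rewrite ip_lin_sqr, <- HX, <- HY in H1.
  destruct (Req_dec (X * Y) 0) as [Z|Z].
  - rewrite Z. destruct (Rle_dec (ip M x y) 0) as [L|L]; [exact L|exfalso].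
    (* If one norm vanishes, a positive inner product p would make this form negative: the
       coefficients chosen below turn its cross term into -2 (Y^2 + 1), respectively -2 (X^2 +
       1). *)
    assert (Hs : forall a b, 0 <= a ^ 2 * X ^ 2 + 2 * a * b * ip M x y + b ^ 2 * Y ^ 2).
    { intros a b. rewrite HX, HY, <- ip_lin_sqr. apply ip_pos. }
    set (p := ip M x y) in *. assert (Hp : 0 < p) by lra.
    apply Rmult_integral in Z. destruct Z as [Z|Z]; rewrite Z in Hs.
    + specialize (Hs (- (Y ^ 2 + 1) / p) 1).
      replace (2 * (- (Y ^ 2 + 1) / p) * 1 * p) with (- 2 * (Y ^ 2 + 1)) in Hs by (field; lra).
      nra.
    + specialize (Hs 1 (- (X ^ 2 + 1) / p)).
      replace (2 * 1 * (- (X ^ 2 + 1) / p) * p) with (- 2 * (X ^ 2 + 1)) in Hs by (field; lra).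
      nra.
  - assert (0 < X * Y) by nra. apply Rmult_le_reg_l with (X * Y); [assumption|]. nra.
Qed.

Lemma vnorm_vadd (M : nat) (x y : vec) : vnorm M (vadd x y) <= vnorm M x + vnorm M y.
Proof.
  pose proof (vnorm_pos M x). pose proof (vnorm_pos M y).
  apply vnorm_le_sqr; [lra|].
  rewrite (ip_ext M _ (fun i => 1 * x i + 1 * y i) _ (fun i => 1 * x i + 1 * y i))
    by (intros; unfold vadd; ring).
  rewrite ip_lin_sqr, <- !vnorm_sqr. pose proof (cauchy_schwarz M x y). nra.
Qed.

Lemma vnorm_vscal (M : nat) (a : R) (x : vec) : vnorm M (vscal a x) = Rabs a * vnorm M x.
Proof.
  unfold vnorm. rewrite <- (sqrt_Rsqr_abs a), <- sqrt_mult;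
    [|apply Rle_0_sqr|apply ip_pos].
  f_equal. unfold Rsqr.
  rewrite (ip_ext M _ (fun i => a * x i + 0 * x i) _ (fun i => a * x i + 0 * x i))
    by (intros; unfold vscal; ring).
  rewrite ip_lin_sqr. ring.
Qed.

Lemma vdist_sym (M : nat) (x y : vec) : vnorm M (vsub x y) = vnorm M (vsub y x).
Proof.
  rewrite (vnorm_ext M (vsub x y) (vscal (-1) (vsub y x))) by (intros; unfold vscal, vsub; ring).
  rewrite vnorm_vscal, Rabs_left by lra. ring.
Qed.

Lemma vdist_tri (M : nat) (x y z : vec) :
  vnorm M (vsub x z) <= vnorm M (vsub x y) + vnorm M (vsub y z).
Proof.
  rewrite (vnorm_ext M (vsub x z) (vadd (vsub x y) (vsub y z)))
    by (intros; unfold vadd, vsub; ring).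
  apply vnorm_vadd.
Qed.

(** * Hypothesis (H) in polynomial form *)

(** The bound G (1 - alpha) = G (r + lam G / 4) is the positive root of t^2 = G^2 (1 + lam t / 2),
    so [tau] lies below it exactly when the quadratic inequality holds. Multiplying by C^2 and using
    G C = sqrt 3 eps |lam| removes G. *)
Lemma hypH_square (eps lam C tau : R) :
  0 < eps -> 0 < tau -> hypH eps lam C tau ->
  (tau * C) ^ 2 <= 3 * eps ^ 2 * lam ^ 2 * (1 + lam * tau / 2).
Proof.
  intros He Ht (Hl & _ & Hle). unfold alphaconst in Hle.
  set (G := Gconst eps lam C) in *.
  rewrite (Rabs_left lam Hl) in Hle.
  set (r := sqrt (1 + (lam * G / 4) ^ 2)) in *.
  assert (Hr : r ^ 2 = 1 + (lam * G / 4) ^ 2) by (apply pow2_sqrt; nra).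
  assert (0 <= r) by apply sqrt_pos.
  assert (Hp : 0 < r + lam * G / 4 /\ 0 < r - lam * G / 4) by (split; nra).
  assert (Hle' : tau <= G * (r + lam * G / 4)) by lra.
  assert (HG : 0 < G) by nra.
  (* The sign of C is read off from G > 0; since [/ 0 = 0], the value C = 0 would give G = 0. *)
  assert (HC : 0 < C).
  { destruct (Rtotal_order C 0) as [HC|[HC|HC]]; [|..|exact HC].
    - unfold G, Gconst in HG. exfalso.
      assert (/ C < 0) by now apply Rinv_lt_0_compat.
      assert (0 < sqrt 3) by (apply sqrt_lt_R0; lra).
      assert (0 < Rabs lam) by (apply Rabs_pos_lt; lra).
      assert (0 < sqrt 3 * eps * Rabs lam) by (repeat apply Rmult_lt_0_compat; lra).
      unfold Rdiv in HG. nra.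
    - exfalso. unfold G, Gconst in HG. rewrite HC in HG. unfold Rdiv in HG.
      rewrite Rinv_0 in HG. lra. }
  assert (HGC : (G * C) ^ 2 = 3 * eps ^ 2 * lam ^ 2).
  { unfold G, Gconst. replace (sqrt 3 * eps * Rabs lam / C * C) with (sqrt 3 * eps * Rabs lam)
      by (field; lra).
    rewrite !Rpow_mult_distr, pow2_sqrt, pow2_abs by lra. ring. }
  assert (Hq : tau ^ 2 <= G ^ 2 * (1 + lam * tau / 2)).
  { assert (H1 : tau - lam * G ^ 2 / 4 <= G * r) by nra.
    assert (0 <= tau - lam * G ^ 2 / 4) by nra.
    assert (H2 : (tau - lam * G ^ 2 / 4) ^ 2 <= (G * r) ^ 2) by (apply pow_incr; lra).
    rewrite (Rpow_mult_distr G r), Hr in H2. nra. }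
  rewrite <- HGC, !Rpow_mult_distr.
  assert (0 <= C ^ 2) by nra. nra.
Qed.

(** * A scalar differential inequality *)

Lemma nonincreasing_endpoints (g dg : R -> R) (b : R) :
  0 <= b ->
  (forall s, 0 <= s <= b -> continuity_pt g s) ->
  (forall s, 0 < s < b -> is_derive g s (dg s)) ->
  (forall s, 0 < s < b -> dg s <= 0) ->
  g b <= g 0.
Proof.
  intros Hb Hc Hd Hn.
  (* [MVT_gen] may return an endpoint, where [dg] is unconstrained. *)
  destruct (MVT_gen g 0 b (fun s => Rmin (dg s) 0)) as [c [_ Hcc]];
    rewrite ?Rmin_left, ?Rmax_right by exact Hb.
  - intros s Hs. rewrite Rmin_left by auto. auto.
  - auto.
  - pose proof (Rmin_r (dg c) 0). nra.
Qed.

(** The polynomial P is a supersolution: P' + m P exceeds C^2 s^2 / m by E m^3 s^2 / 2 + C^2 s^3 /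
    3. Hence exp (m s) (phi - P) is nonincreasing. The factor 1 - x + x^2 / 2 is a Taylor upper
    bound of exp (-x), and it equals 1 - q for x = m tau. Derivatives are asked only in the open
    interval because a trajectory may have a kink at a switching time. *)
Lemma exp_neg_sub_bound (phi dphi : R -> R) (tau m C E : R) :
  0 < m -> 0 <= tau -> 0 <= E ->
  (forall s, 0 <= s <= tau -> continuity_pt phi s) ->
  (forall s, 0 < s < tau -> is_derive phi s (dphi s)) ->
  (forall s, 0 < s < tau -> dphi s <= - m * phi s + C ^ 2 * s ^ 2 / m) ->
  phi 0 <= E ->
  phi tau <= E * (1 - m * tau + (m * tau) ^ 2 / 2) + C ^ 2 * tau ^ 3 / (3 * m).
Proof.
  intros Hm Ht HE Hc Hd Hle H0.
  set (P := fun s => E * (1 - m * s + (m * s) ^ 2 / 2) + C ^ 2 * s ^ 3 / (3 * m)).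
  set (dP := fun s => E * (- m + m ^ 2 * s) + C ^ 2 * s ^ 2 / m).
  assert (HP : forall s, is_derive P s (dP s)).
  { intros s. unfold P, dP. auto_derive; [trivial|]. field. lra. }
  assert (Hmono : exp (m * tau) * (phi tau - P tau) <= exp (m * 0) * (phi 0 - P 0)).
  { apply (nonincreasing_endpoints (fun s => exp (m * s) * (phi s - P s))
      (fun s => m * exp (m * s) * (phi s - P s) + exp (m * s) * (dphi s - dP s))); [exact Ht| | |].
    - intros s Hs. apply continuity_pt_mult.
      + apply derivable_continuous_pt. exists (m * exp (m * s)).
        apply is_derive_Reals. auto_derive; [trivial|ring].
      + apply continuity_pt_minus; [auto|].
        apply derivable_continuous_pt. exists (dP s). now apply is_derive_Reals.
    - intros s Hs.
      apply (is_derive_mult (fun s => exp (m * s)) (fun s => phi s - P s)).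
      + auto_derive; [trivial|ring].
      + apply (is_derive_minus phi P s); auto.
      + exact Rmult_comm.
    - intros s Hs. pose proof (exp_pos (m * s)). specialize (Hle s Hs).
      assert (dphi s - dP s + m * (phi s - P s) <= 0); [|nra].
      assert (C ^ 2 * s ^ 2 / m + E * m ^ 3 * s ^ 2 / 2 + C ^ 2 * s ^ 3 / 3 = dP s + m * P s)
        by (unfold dP, P; field; lra).
      assert (0 <= E * m ^ 3 * s ^ 2) by (repeat apply Rmult_le_pos; try apply pow_le; lra).
      assert (0 <= C ^ 2 * s ^ 3) by (apply Rmult_le_pos; [apply pow2_ge_0|apply pow_le; lra]).
      nra. }
  rewrite Rmult_0_r, exp_0 in Hmono.
  assert (P 0 = E) by (unfold P; field; lra).
  pose proof (exp_pos (m * tau)). fold (P tau). nra.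
Qed.

(** * Calculus of finite sums and clamped time *)

Lemma is_derive_sumn (n : nat) (g : nat -> R -> R) (dg : nat -> R) (s : R) :
  (forall i, (i < n)%nat -> is_derive (g i) s (dg i)) ->
  is_derive (fun s => sumn n (fun i => g i s)) s (sumn n dg).
Proof.
  induction n as [|n IH]; intros H; simpl.
  - apply (is_derive_const (K := R_AbsRing) (V := R_NormedModule)).
  - apply (is_derive_plus (fun s => sumn n (fun i => g i s)) (g n)); auto.
Qed.

Lemma continuity_pt_sumn (n : nat) (g : nat -> R -> R) (s : R) :
  (forall i, (i < n)%nat -> continuity_pt (g i) s) ->
  continuity_pt (fun s => sumn n (fun i => g i s)) s.
Proof.
  induction n as [|n IH]; intros H; simpl.
  - now apply continuity_pt_const; intros ? ?.
  - apply (continuity_pt_plus (fun s => sumn n (fun i => g i s)) (g n)); auto.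
Qed.

(** Freezing time outside [0, b] turns the one-sided continuity of a trajectory at the ends of a
    step into the two-sided [continuity_pt]. *)
Definition clamp (b s : R) : R := Rmax 0 (Rmin s b).

Lemma clamp_id (b s : R) : 0 <= s <= b -> clamp b s = s.
Proof. intros H. unfold clamp. rewrite Rmin_left, Rmax_right; lra. Qed.

Lemma clamp_range (b s : R) : 0 <= b -> 0 <= clamp b s <= b.
Proof.
  intros H. unfold clamp. split; [apply Rmax_l|].
  apply Rmax_lub; [exact H|apply Rmin_r].
Qed.

Lemma clamp_lip (b s t : R) : Rabs (clamp b s - clamp b t) <= Rabs (s - t).
Proof.
  unfold clamp, Rmin.
  destruct (Rle_dec s b), (Rle_dec t b); unfold Rmax;
    repeat (match goal with |- context [Rle_dec ?u ?w] => destruct (Rle_dec u w) end);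
    unfold Rabs;
    repeat (match goal with |- context [Rcase_abs ?u] => destruct (Rcase_abs u) end); lra.
Qed.

(** * One time step of a single mode *)

Section EulerStep.

Variables (M : nat) (g : vec -> vec) (Lc C m tau eps : R).
Hypothesis Hm : 0 < m.
Hypothesis Htau : 0 < tau.
Hypothesis Heps : 0 < eps.
Hypothesis Hlip : lipschitz_on_S M g Lc.
Hypothesis Hosl : osl_on_S M g (- m).
Hypothesis HC : forall w, inS M w -> Lc * vnorm M (g w) <= C.
Hypothesis Hsmall : (tau * C) ^ 2 <= 3 * eps ^ 2 * m ^ 2 * (1 - m * tau / 2).

Let q := m * tau * (1 - m * tau / 2).

(** Expanding the square, the cross term is controlled by the one-sided Lipschitz bound. In the
    square of |g a - g b|, one factor is bounded by the Lipschitz constant and the other by |g a| +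
    |g b|, so that only products [Lc * vnorm M (g w)], hence C, remain. *)
Lemma euler_step_sqr (a b : vec) :
  inS M a -> inS M b ->
  ip M (vsub (vadd a (vscal tau (g a))) (vadd b (vscal tau (g b))))
       (vsub (vadd a (vscal tau (g a))) (vadd b (vscal tau (g b))))
  <= vnorm M (vsub a b) ^ 2 - 2 * m * tau * vnorm M (vsub a b) ^ 2
     + 2 * tau * vnorm M (vsub a b) * (tau * C).
Proof.
  intros Ha Hb.
  rewrite (ip_ext M _ (fun i => 1 * vsub a b i + tau * vsub (g a) (g b) i)
    _ (fun i => 1 * vsub a b i + tau * vsub (g a) (g b) i))
    by (intros; unfold vsub, vadd, vscal; ring).
  rewrite ip_lin_sqr, <- !vnorm_sqr.
  pose proof (Hosl a b Ha Hb) as Ho. pose proof (Hlip a b Ha Hb) as Hl.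
  rewrite ip_sym in Ho.
  pose proof (HC a Ha) as Ca. pose proof (HC b Hb) as Cb.
  pose proof (vdist_tri M (g a) (fun _ => 0) (g b)) as Ht.
  rewrite (vdist_sym M (fun _ => 0)) in Ht.
  rewrite (vnorm_ext M (vsub (g a) (fun _ => 0)) (g a)) in Ht by (intros; unfold vsub; ring).
  rewrite (vnorm_ext M (vsub (g b) (fun _ => 0)) (g b)) in Ht by (intros; unfold vsub; ring).
  pose proof (vnorm_pos M (vsub a b)). pose proof (vnorm_pos M (vsub (g a) (g b))).
  set (d := vnorm M (vsub a b)) in *. set (n := vnorm M (vsub (g a) (g b))) in *.
  assert (Hn : n ^ 2 <= 2 * C * d).
  { apply Rle_trans with (Lc * d * n); [nra|].
    apply Rle_trans with (Lc * d * (vnorm M (g a) + vnorm M (g b))); [nra|].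
    nra. }
  assert (tau ^ 2 * n ^ 2 <= tau ^ 2 * (2 * C * d)) by (apply Rmult_le_compat_l; nra).
  nra.
Qed.

(** [Hsmall] bounds a square, which forces m tau <= 2; and q = (1 - (1 - m tau)^2) / 2. *)
Lemma q_bounds : 0 <= q <= 1 / 2.
Proof.
  unfold q. assert (0 <= 1 - m * tau / 2).
  { assert (0 < 3 * eps ^ 2 * m ^ 2) by (apply Rmult_lt_0_compat; nra).
    pose proof (pow2_ge_0 (tau * C)).
    apply Rmult_le_reg_l with (3 * eps ^ 2 * m ^ 2); lra. }
  assert (0 < m * tau) by (now apply Rmult_lt_0_compat).
  split; [nra|]. pose proof (pow2_ge_0 (m * tau - 1)). nra.
Qed.

(* For [d < sqrt 3 * eps] an Euler step can expand distances. *)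
Lemma euler_step_expansion (a b : vec) :
  inS M a -> inS M b ->
  vnorm M (vsub (vadd a (vscal tau (g a))) (vadd b (vscal tau (g b)))) ^ 2
  <= vnorm M (vsub a b) ^ 2 + 3 / 2 * q * eps ^ 2.
Proof.
  intros Ha Hb. rewrite vnorm_sqr.
  eapply Rle_trans; [apply euler_step_sqr; auto|].
  set (d := vnorm M (vsub a b)). set (p := tau * C) in *.
  (* p^2 / (2 m) is the maximum of 2 d p - 2 m d^2 over d, so the resulting bound on the expansion
     is independent of d. *)
  assert (H : 2 * d * p <= 2 * m * d ^ 2 + p ^ 2 / (2 * m)).
  { pose proof (pow2_ge_0 (2 * m * d - p)).
    apply Rmult_le_reg_r with (2 * m); [lra|].
    replace ((2 * m * d ^ 2 + p ^ 2 / (2 * m)) * (2 * m)) with (4 * m ^ 2 * d ^ 2 + p ^ 2)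
      by (field; lra). nra. }
  assert (H2 : p ^ 2 / (2 * m) <= 3 / 2 * eps ^ 2 * m * (1 - m * tau / 2)).
  { apply Rmult_le_reg_r with (2 * m); [lra|].
    replace (p ^ 2 / (2 * m) * (2 * m)) with (p ^ 2) by (field; lra). nra. }
  unfold q. nra.
Qed.

(** If d^2 >= 3 eps^2, then [Hsmall] gives tau C <= m d and contraction absorbs the quadratic error.
    Otherwise the expansion is at most 3/4 eps^2, and 3 + 3/4 < 4 keeps the distance below 2 eps. *)
Lemma euler_step_nonexpansive (a b : vec) (D : R) :
  inS M a -> inS M b -> 2 * eps <= D -> vnorm M (vsub a b) <= D ->
  vnorm M (vsub (vadd a (vscal tau (g a))) (vadd b (vscal tau (g b)))) <= D.
Proof.
  intros Ha Hb HD Hd. pose proof q_bounds.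
  pose proof (euler_step_expansion a b Ha Hb) as H1.
  pose proof (euler_step_sqr a b Ha Hb) as H2.
  pose proof (vnorm_pos M (vsub a b)).
  apply vnorm_le_sqr; [lra|].
  set (d := vnorm M (vsub a b)) in *.
  destruct (Rle_dec (3 * eps ^ 2) (d ^ 2)) as [L|L].
  - eapply Rle_trans; [exact H2|].
    assert (tau * C <= m * d).
    { destruct (Rle_dec (tau * C) (m * d)) as [L'|L']; [exact L'|exfalso].
      assert (0 <= m * d) by nra.
      assert ((m * d) ^ 2 < (tau * C) ^ 2) by nra.
      assert (3 * eps ^ 2 * m ^ 2 <= (m * d) ^ 2) by nra.
      assert (0 < m * tau) by nra. assert (0 < eps ^ 2 * m ^ 2) by nra. nra. }
    assert (tau * d * (tau * C) <= tau * d * (m * d)) by (apply Rmult_le_compat_l; nra).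
    nra.
  - rewrite vnorm_sqr in H1. eapply Rle_trans; [exact H1|]. nra.
Qed.

(** The exact flow is compared with the segment b = a + s g(a). The derivative of the squared
    distance splits into a part with g(Y) - g(b), which contracts at rate 2 m, and a part with g(b)
    - g(a), of norm at most C s. Half of the contraction absorbs the latter, which leaves the
    inequality of [exp_neg_sub_bound]. *)
Lemma flow_step (Y : R -> vec) (t0 d : R) (a : vec) :
  (forall i, (i < M)%nat -> forall t, t0 <= t <= t0 + tau -> forall e, e > 0 ->
     exists r, r > 0 /\ forall s, t0 <= s <= t0 + tau -> Rabs (s - t) < r ->
       Rabs (Y s i - Y t i) < e) ->
  (forall t, t0 < t < t0 + tau -> forall i, (i < M)%nat ->
     derivable_pt_lim (fun s => Y s i) t (g (Y t) i)) ->
  (forall t, t0 <= t <= t0 + tau -> inS M (Y t)) ->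
  (forall s, 0 <= s <= tau -> inS M (vadd a (vscal s (g a)))) ->
  vnorm M (vsub (Y t0) a) <= d ->
  vnorm M (vsub (Y (t0 + tau)) (vadd a (vscal tau (g a)))) ^ 2
  <= d ^ 2 - q * (d ^ 2 - eps ^ 2).
Proof.
  intros Hcont Hder HY HE Hd. rewrite vnorm_sqr.
  assert (Ha : inS M a).
  { intros i Hi. specialize (HE 0 ltac:(lra) i Hi). unfold vadd, vscal in HE.
    now rewrite Rmult_0_l, Rplus_0_r in HE. }
  set (v := fun s i => Y (t0 + clamp tau s) i - (a i + s * g a i)).
  set (phi := fun s => ip M (v s) (v s)).
  set (dphi := fun s => sumn M (fun i => (g (Y (t0 + s)) i - g a i) * v s i
                                          + v s i * (g (Y (t0 + s)) i - g a i))).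
  assert (Hv : forall s, 0 <= s <= tau -> forall i,
    v s i = vsub (Y (t0 + s)) (vadd a (vscal s (g a))) i).
  { intros s Hs i. unfold v. now rewrite clamp_id. }
  assert (Hphi : phi tau <= d ^ 2 * (1 - m * tau + (m * tau) ^ 2 / 2)
                            + C ^ 2 * tau ^ 3 / (3 * m)).
  { apply (exp_neg_sub_bound phi dphi); [lra|lra|apply pow2_ge_0| | | |].
    - intros s _. apply continuity_pt_sumn. intros i Hi.
      assert (continuity_pt (fun s => v s i) s); [|now apply continuity_pt_mult].
      apply continuity_pt_minus.
      + apply continuity_pt_locally. intros e.
        pose proof (clamp_range tau s ltac:(lra)) as Rs.
        destruct (Hcont i Hi (t0 + clamp tau s) ltac:(lra) e (cond_pos e)) as [r [Hr Hr']].
        exists (mkposreal r Hr). intros s' Hs'.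
        pose proof (clamp_range tau s' ltac:(lra)).
        apply Hr'; [lra|].
        replace (t0 + clamp tau s' - (t0 + clamp tau s)) with (clamp tau s' - clamp tau s) by ring.
        eapply Rle_lt_trans; [apply clamp_lip|exact Hs'].
      + apply derivable_continuous_pt. exists (g a i).
        apply is_derive_Reals. auto_derive; [trivial|ring].
    - intros s Hs. unfold phi, ip, dphi.
      apply (is_derive_sumn M (fun i s => v s i * v s i)). intros i Hi.
      assert (Hvi : is_derive (fun s => v s i) s (g (Y (t0 + s)) i - g a i)).
      { apply is_derive_minus with (f := fun s => Y (t0 + clamp tau s) i)
          (g := fun s => a i + s * g a i).
        - apply is_derive_ext_loc with (fun s => Y (t0 + s) i).
          + assert (Hr : 0 < Rmin s (tau - s)) by (apply Rmin_pos; lra).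
            exists (mkposreal _ Hr). intros s' Hs'.
            change (Rabs (s' - s) < Rmin s (tau - s)) in Hs'.
            pose proof (Rmin_l s (tau - s)). pose proof (Rmin_r s (tau - s)).
            apply Rabs_def2 in Hs'. rewrite clamp_id; [reflexivity|lra].
          + replace (g (Y (t0 + s)) i) with (scal 1 (g (Y (t0 + s)) i)) by apply Rmult_1_l.
            apply (is_derive_comp (fun t => Y t i) (fun s => t0 + s)).
            * apply is_derive_Reals, Hder; [lra|exact Hi].
            * auto_derive; [trivial|ring].
        - auto_derive; [trivial|ring]. }
      apply (is_derive_mult (fun s => v s i) (fun s => v s i) s); auto.
      exact Rmult_comm.
    - intros s Hs.
      set (b := vadd a (vscal s (g a))).
      assert (Hb : inS M b) by (apply HE; lra).
      assert (HYs : inS M (Y (t0 + s))) by (apply HY; lra).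
      assert (E1 : dphi s = 2 * (ip M (vsub (g (Y (t0 + s))) (g b)) (vsub (Y (t0 + s)) b)
                                 + ip M (vsub (g b) (g a)) (v s))).
      { rewrite (ip_ext M _ (vsub (g (Y (t0 + s))) (g b)) (vsub (Y (t0 + s)) b) (v s))
          by (intros; rewrite ?Hv by lra; reflexivity).
        unfold dphi, ip.
        transitivity (2 * (1 * sumn M (fun i => vsub (g (Y (t0 + s))) (g b) i * v s i)
                           + 1 * sumn M (fun i => vsub (g b) (g a) i * v s i))); [|ring].
        rewrite <- sumn_lin.
        (* A null sum is added to supply the second term of the pattern of [sumn_lin]. *)
        rewrite <- (Rplus_0_r (2 * _)), <- (Rmult_0_l (sumn M (fun _ => 0))), <- sumn_lin.
        apply sumn_ext. intros i Hi. unfold vsub. ring. }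
      assert (E2 : phi s = vnorm M (v s) ^ 2) by (symmetry; apply vnorm_sqr).
      assert (E3 : vnorm M (vsub (Y (t0 + s)) b) = vnorm M (v s))
        by (apply vnorm_ext; intros; rewrite Hv by lra; reflexivity).
      pose proof (Hosl _ _ HYs Hb) as Ho. rewrite E3 in Ho.
      pose proof (cauchy_schwarz M (vsub (g b) (g a)) (v s)) as Hcs.
      pose proof (Hlip _ _ Hb Ha) as Hl.
      rewrite (vnorm_ext M (vsub b a) (vscal s (g a))) in Hl
        by (intros; unfold b, vsub, vadd, vscal; ring).
      rewrite vnorm_vscal, Rabs_pos_eq in Hl by lra.
      pose proof (HC a Ha). pose proof (vnorm_pos M (v s)).
      pose proof (vnorm_pos M (vsub (g b) (g a))).
      set (n := vnorm M (v s)) in *.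
      assert (Hn : vnorm M (vsub (g b) (g a)) <= C * s) by nra.
      assert (H5 : vnorm M (vsub (g b) (g a)) * n <= C * s * n) by nra.
      rewrite E1, E2.
      assert (H6 : 2 * (C * s * n) <= m * n ^ 2 + C ^ 2 * s ^ 2 / m).
      { apply Rmult_le_reg_r with m; [lra|].
        replace ((m * n ^ 2 + C ^ 2 * s ^ 2 / m) * m) with (m ^ 2 * n ^ 2 + (C * s) ^ 2)
          by (field; lra).
        pose proof (pow2_ge_0 (m * n - C * s)). nra. }
      lra.
    - unfold phi. apply ip_le_sqr.
      rewrite (vnorm_ext M _ (vsub (Y t0) a)); [exact Hd|].
      intros i Hi. rewrite Hv by lra. unfold vsub, vadd, vscal.
      rewrite Rplus_0_r. ring. }
  rewrite (ip_ext M _ (v tau) _ (v tau)) by (intros; rewrite Hv by lra; reflexivity).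
  fold (phi tau).
  (* The factor 3 of [Hsmall] cancels the 3 from integrating s^2, which leaves exactly q eps^2. *)
  assert (H2 : C ^ 2 * tau ^ 3 / (3 * m) <= q * eps ^ 2).
  { apply Rmult_le_reg_r with (3 * m); [lra|].
    replace (C ^ 2 * tau ^ 3 / (3 * m) * (3 * m)) with (tau * (tau * C) ^ 2) by (field; lra).
    unfold q. nra. }
  unfold q in *. lra.
Qed.

End EulerStep.

(** * Finite minima, patterns, modes and rounding to the grid *)

Lemma lmin_le (l : list R) (x : R) : In x l -> lmin l <= x.
Proof.
  induction l as [|a l IH]; [easy|]. intros Hx.
  destruct l as [|b l].
  - destruct Hx as [->|[]]. simpl. lra.
  - change (Rmin a (lmin (b :: l)) <= x). destruct Hx as [->|Hx].
    + apply Rmin_l.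
    + eapply Rle_trans; [apply Rmin_r|auto].
Qed.

Lemma lmin_in (l : list R) : l <> nil -> In (lmin l) l.
Proof.
  induction l as [|a l IH]; [easy|]. intros _.
  destruct l as [|b l]; [now left|].
  change (In (Rmin a (lmin (b :: l))) (a :: b :: l)).
  unfold Rmin. destruct (Rle_dec a (lmin (b :: l))); [now left|].
  right. now apply IH.
Qed.

Lemma patterns_spec (U : list mode) (k : nat) (pi : list mode) :
  In pi (patterns U k) <-> length pi = k /\ forall u, In u pi -> In u U.
Proof.
  revert pi. induction k as [|k IH]; intros pi; simpl.
  - split.
    + now intros [<-|[]].
    + intros [H _]. left. symmetry. now apply length_zero_iff_nil.
  - rewrite in_flat_map. split.
    + intros (u & Hu & H). apply in_map_iff in H. destruct H as (r & <- & Hr).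
      apply IH in Hr. destruct Hr as [Hl Hr]. split; [simpl; now f_equal|].
      intros w [<-|Hw]; auto.
    + destruct pi as [|u r]; [easy|]. intros [Hl H].
      exists u. split; [apply H; now left|]. apply in_map, IH.
      split; [simpl in Hl; lia|]. intros w Hw. apply H. now right.
Qed.

(** The mode enters only through [phih], which cancels in differences. A common rate gives a common
    q, so that expansion along one pattern can be balanced against contraction along another. *)
Lemma osl_fmode_indep (M : nat) (L sigma : R) (f : vec -> vec) (u w : mode) (c : R) :
  osl_on_S M (fmode M L sigma f u) c -> osl_on_S M (fmode M L sigma f w) c.
Proof.
  intros H y1 y2 H1 H2. specialize (H y1 y2 H1 H2).
  rewrite (ip_ext M _ (vsub (fmode M L sigma f u y1) (fmode M L sigma f u y2)) _ (vsub y1 y2));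
    [exact H| |reflexivity].
  intros. unfold vsub, fmode. ring.
Qed.

(** Each coordinate moves by at most half a cell width, so the norm is at most sqrt M / (2 K). *)
Lemma rep_dist (M K : nat) (eps : R) (rep : vec -> vec) (y : vec) :
  0 < eps -> (0 < K)%nat -> sqrt (INR M) / (2 * eps) <= INR K ->
  is_rep M K rep -> inS M y -> vnorm M (vsub y (rep y)) <= eps.
Proof.
  intros He HK HM Hrep Hy. apply vnorm_le_sqr; [lra|].
  assert (HK' : 0 < INR K) by (now apply (lt_INR 0)).
  destruct (Hrep y Hy) as [_ Hd].
  apply Rle_trans with (INR M * (1 / (2 * INR K)) ^ 2).
  - apply sumn_le_const. intros i Hi. specialize (Hd i Hi).
    change (vsub y (rep y) i) with (y i - rep y i).
    rewrite <- (pow2_abs (1 / (2 * INR K))).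
    replace ((y i - rep y i) * (y i - rep y i)) with (Rabs (y i - rep y i) ^ 2)
      by (rewrite pow2_abs; ring).
    apply pow_incr. split; [apply Rabs_pos|].
    eapply Rle_trans; [exact Hd|apply Rle_abs].
  - assert (Hs : sqrt (INR M) <= 2 * eps * INR K).
    { apply Rmult_le_reg_r with (/ (2 * eps)); [apply Rinv_0_lt_compat; lra|].
      replace (2 * eps * INR K * / (2 * eps)) with (INR K) by (field; lra). exact HM. }
    assert (HM2 : INR M <= (2 * eps * INR K) ^ 2).
    { rewrite <- (pow2_sqrt (INR M)) by apply pos_INR.
      apply pow_incr. split; [apply sqrt_pos|exact Hs]. }
    apply Rmult_le_reg_r with ((2 * INR K) ^ 2); [apply pow_lt; lra|].
    replace (INR M * (1 / (2 * INR K)) ^ 2 * (2 * INR K) ^ 2) with (INR M) by (field; lra).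
    nra.
Qed.

Lemma center_inS (M K : nat) (z : vec) : is_center M K z -> inS M z.
Proof.
  intros H i Hi. destruct (H i Hi) as (j & Hj & ->).
  assert (H1 : INR j + 1 <= INR K) by (rewrite <- S_INR; apply le_INR; lia).
  pose proof (pos_INR j).
  split.
  - apply Rmult_le_pos; [lra|]. left. apply Rinv_0_lt_compat. lra.
  - apply Rmult_le_reg_r with (2 * INR K); [lra|].
    replace ((2 * INR j + 1) / (2 * INR K) * (2 * INR K)) with (2 * INR j + 1) by (field; lra).
    lra.
Qed.

(** * Iteration along patterns and dynamic programming *)

Section Patterns.

Variables (M K : nat) (F : mode -> vec -> vec) (tau : R) (rep : vec -> vec)
  (U : list mode) (yf : vec) (sel : nat -> vec -> mode).

Definition euler_step (u : mode) (z : vec) : vec := vadd z (vscal tau (F u z)).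

Fixpoint euler_end (pi : list mode) (z : vec) : vec :=
  match pi with
  | nil => z
  | u :: r => euler_end r (euler_step u z)
  end.

(** End of the Euler trajectory rounded after every step: the points at which [vdp] evaluates
    patterns. *)
Fixpoint grid_end (pi : list mode) (z : vec) : vec :=
  match pi with
  | nil => z
  | u :: r => grid_end r (next F tau rep u z)
  end.

Lemma euler_at_end (pi : list mode) (z : vec) :
  0 < tau -> euler F tau pi (INR (length pi) * tau) z = euler_end pi z.
Proof.
  intros Ht. revert z. induction pi as [|u r IH]; intros z; [reflexivity|].
  cbn [euler euler_end]. change (length (u :: r)) with (S (length r)). rewrite S_INR.
  replace ((INR (length r) + 1) * tau - tau) with (INR (length r) * tau) by ring.
  (* At the final time the test [t <= tau] succeeds, with equality, only on the last letter. *)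
  destruct (Rle_dec _ _) as [Hle|Hle]; [|apply IH].
  destruct r as [|w r].
  - simpl. unfold euler_step. do 2 f_equal. ring.
  - exfalso. pose proof (pos_INR (length r)).
    change (length (w :: r)) with (S (length r)) in Hle. rewrite S_INR in Hle. nra.
Qed.

Hypothesis Hrep : is_rep M K rep.
Hypothesis Hstep : forall u z, In u U -> inS M z -> inS M (euler_step u z).

Lemma next_center (u : mode) (z : vec) :
  In u U -> is_center M K z -> is_center M K (next F tau rep u z).
Proof. intros Hu Hz. apply Hrep, Hstep; [exact Hu|]. now apply center_inS with K. Qed.

Lemma vdp_le_grid (pi : list mode) (z : vec) :
  (forall u, In u pi -> In u U) ->
  vdp M F tau rep U yf (length pi) z <= vnorm M (vsub (grid_end pi z) yf).
Proof.
  revert z. induction pi as [|u r IH]; intros z H; simpl; [lra|].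
  eapply Rle_trans; [|apply IH; intros; apply H; now right].
  apply lmin_le.
  apply (in_map (fun u => vdp M F tau rep U yf (length r) (next F tau rep u z))).
  apply H. now left.
Qed.

Hypothesis Hsel : is_sel M K F tau rep U yf sel.

Lemma pidp_in_patterns (k : nat) (z : vec) :
  is_center M K z -> In (pidp F tau rep sel k z) (patterns U k).
Proof.
  intros Hz. apply patterns_spec. revert z Hz.
  induction k as [|k IH]; intros z Hz; simpl; [easy|].
  destruct (Hsel (S k) z ltac:(lia) Hz) as [Hu _].
  destruct (IH _ (next_center _ _ Hu Hz)) as [Hl Hr].
  split; [now f_equal|]. intros w [<-|Hw]; auto.
Qed.

(** Every letter of [pidp] attains the minimum in the recursion of [vdp]. Together with
    [vdp_le_grid], this makes [pidp] optimal among grid trajectories from z. *)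
Lemma grid_pidp (k : nat) (z : vec) :
  is_center M K z ->
  vnorm M (vsub (grid_end (pidp F tau rep sel k z) z) yf) = vdp M F tau rep U yf k z.
Proof.
  revert z. induction k as [|k IH]; intros z Hz; [reflexivity|].
  destruct (Hsel (S k) z ltac:(lia) Hz) as [Hu Hmin].
  cbn [pidp grid_end vdp]. rewrite IH by now apply next_center.
  replace (S k - 1)%nat with k in Hmin by lia.
  set (V := fun u => vdp M F tau rep U yf k (next F tau rep u z)) in *.
  change (V (sel (S k) z) = lmin (map V U)).
  apply Rle_antisym.
  - assert (Hin : In (lmin (map V U)) (map V U)).
    { apply lmin_in. destruct U; [destruct Hu|discriminate]. }
    apply in_map_iff in Hin. destruct Hin as (u & <- & Hin). now apply Hmin.
  - apply lmin_le. now apply in_map.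
Qed.

Variables (eps q : R).
Hypothesis Heps : 0 < eps.
Hypothesis Hq : 0 <= q <= 1 / 2.
Hypothesis Hround : forall w, inS M w -> vnorm M (vsub w (rep w)) <= eps.
Hypothesis Hexpand : forall u a b, In u U -> inS M a -> inS M b ->
  vnorm M (vsub (euler_step u a) (euler_step u b)) ^ 2
  <= vnorm M (vsub a b) ^ 2 + 3 / 2 * q * eps ^ 2.
Hypothesis Hnonexp : forall u a b D, In u U -> inS M a -> inS M b ->
  2 * eps <= D -> vnorm M (vsub a b) <= D ->
  vnorm M (vsub (euler_step u a) (euler_step u b)) <= D.

Lemma next_inS (u : mode) (z : vec) : In u U -> inS M z -> inS M (next F tau rep u z).
Proof. intros Hu Hz. apply center_inS with K, Hrep. now apply Hstep. Qed.

Lemma next_dist (u : mode) (a b : vec) (D : R) :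
  In u U -> inS M b -> vnorm M (vsub a (euler_step u b)) <= D ->
  vnorm M (vsub a (next F tau rep u b)) <= D + eps.
Proof.
  intros Hu Hb H. eapply Rle_trans; [apply vdist_tri|].
  apply Rplus_le_compat; [exact H|]. apply Hround. now apply Hstep.
Qed.

(** From 2 eps on, only rounding increases the distance, and the growing bound D stays in the
    nonexpansive regime. *)
Lemma euler_grid_far (pi : list mode) (a b : vec) (D : R) :
  (forall u, In u pi -> In u U) -> inS M a -> inS M b ->
  2 * eps <= D -> vnorm M (vsub a b) <= D ->
  vnorm M (vsub (euler_end pi a) (grid_end pi b)) <= D + INR (length pi) * eps.
Proof.
  revert a b D. induction pi as [|u r IH]; intros a b D HU Ha Hb HD Hd.
  - simpl. lra.
  - cbn [euler_end grid_end length]. rewrite S_INR.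
    assert (Hu : In u U) by (apply HU; now left).
    replace (D + (INR (length r) + 1) * eps) with (D + eps + INR (length r) * eps) by ring.
    apply IH; auto using next_inS.
    + intros; apply HU; now right.
    + lra.
    + apply next_dist; auto.
Qed.

(* The exact trajectory, sampled at multiples of [tau], attracts Euler steps:
   for [d > eps] the bound is a strict contraction. *)
Definition shadowed (p : nat -> vec) (pi : list mode) : Prop :=
  forall j, (j < length pi)%nat -> forall a d, inS M a -> eps <= d ->
    vnorm M (vsub (p j) a) <= d ->
    vnorm M (vsub (p (S j)) (euler_step (nth j pi (0, 0)) a)) ^ 2
    <= d ^ 2 - q * (d ^ 2 - eps ^ 2).

Lemma shadowed_tail (p : nat -> vec) (u : mode) (r : list mode) :
  shadowed p (u :: r) -> shadowed (fun j => p (S j)) r.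
Proof.
  intros H j Hj. apply (H (S j)). simpl. lia.
Qed.

Lemma shadowed_head (p : nat -> vec) (u : mode) (r : list mode) (a : vec) (d : R) :
  shadowed p (u :: r) -> inS M a -> eps <= d -> vnorm M (vsub (p O) a) <= d ->
  vnorm M (vsub (p 1%nat) (euler_step u a)) ^ 2 <= d ^ 2 - q * (d ^ 2 - eps ^ 2).
Proof. intros H. apply (H O). simpl. lia. Qed.

Lemma shadowed_head_le (p : nat -> vec) (u : mode) (r : list mode) (a : vec) (d : R) :
  shadowed p (u :: r) -> inS M a -> eps <= d -> vnorm M (vsub (p O) a) <= d ->
  vnorm M (vsub (p 1%nat) (euler_step u a)) <= d.
Proof.
  intros H Ha Hd H0. apply vnorm_le_sqr; [lra|]. rewrite <- vnorm_sqr.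
  eapply Rle_trans; [now apply shadowed_head with (r := r) (d := d)|].
  assert (0 <= q * (d ^ 2 - eps ^ 2)) by (apply Rmult_le_pos; nra). lra.
Qed.

(** d = eps is a fixed point of the one-step bound, and without rounding nothing is added to it. *)
Lemma shadowed_euler (pi : list mode) (p : nat -> vec) (a : vec) :
  (forall u, In u pi -> In u U) -> shadowed p pi -> inS M a ->
  vnorm M (vsub (p O) a) <= eps ->
  vnorm M (vsub (p (length pi)) (euler_end pi a)) <= eps.
Proof.
  revert p a. induction pi as [|u r IH]; intros p a HU H Ha Hd; [exact Hd|].
  cbn [euler_end length].
  apply (IH (fun j => p (S j))).
  - intros; apply HU; now right.
  - now apply shadowed_tail with u.
  - apply Hstep; [apply HU; now left|exact Ha].
  - now apply shadowed_head_le with r; [..|lra|].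
Qed.

(** The one-step bound never exceeds d when d >= eps, so each step costs only its rounding. *)
Lemma shadowed_grid (pi : list mode) (p : nat -> vec) (a : vec) (d : R) :
  (forall u, In u pi -> In u U) -> shadowed p pi -> inS M a ->
  eps <= d -> vnorm M (vsub (p O) a) <= d ->
  vnorm M (vsub (p (length pi)) (grid_end pi a)) <= d + INR (length pi) * eps.
Proof.
  revert p a d. induction pi as [|u r IH]; intros p a d HU H Ha Hed Hd; [simpl; lra|].
  cbn [grid_end length]. rewrite S_INR.
  assert (Hu : In u U) by (apply HU; now left).
  replace (d + (INR (length r) + 1) * eps) with (d + eps + INR (length r) * eps) by ring.
  apply (IH (fun j => p (S j))); auto using next_inS.
  - intros; apply HU; now right.
  - now apply shadowed_tail with u.
  - lra.
  - apply next_dist; auto. now apply shadowed_head_le with r.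
Qed.

(* In the second step the possible expansion [3 q / 4 * eps] of the Euler map is
   compensated by the contraction of the exact flow. *)
Lemma euler_vs_grid_vs_exact (pi pi' : list mode) (p : nat -> vec) (z : vec) (k : nat) :
  (1 <= k)%nat -> length pi = k -> length pi' = k ->
  (forall u, In u pi -> In u U) -> (forall u, In u pi' -> In u U) ->
  shadowed p pi' -> inS M z -> vnorm M (vsub (p O) z) <= eps ->
  vnorm M (vsub (euler_end pi z) (grid_end pi z))
  + vnorm M (vsub (p k) (grid_end pi' z)) <= (2 * INR k + 1) * eps.
Proof.
  intros Hk Hl Hl' HU HU' Hp Hz Hd.
  (* Both Euler trajectories start at z, so after one step only a rounding separates them. *)
  assert (first : forall u, In u U ->
    vnorm M (vsub (euler_step u z) (next F tau rep u z)) <= eps).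
  { intros u Hu. apply Hround. now apply Hstep. }
  destruct pi as [|u1 [|u2 r]], pi' as [|w1 [|w2 r']]; simpl in Hl, Hl'; try lia.
  (* For one step the two distances are at most eps and 2 eps. *)
  - subst k. pose proof (shadowed_grid [w1] p z eps HU' Hp Hz ltac:(lra) Hd) as H1.
    specialize (first u1 (HU u1 (or_introl eq_refl))).
    simpl in *. lra.
  - destruct k as [|[|n]]; try lia.
    assert (length r = n) by lia. assert (length r' = n) by lia. clear Hl Hl'.
    assert (Hu1 : In u1 U) by (apply HU; simpl; auto).
    assert (Hu2 : In u2 U) by (apply HU; simpl; auto).
    assert (Hw1 : In w1 U) by (apply HU'; simpl; auto).
    assert (Hw2 : In w2 U) by (apply HU'; simpl; auto).
    (* The second Euler step expands eps to at most sqrt (1 + 3/2 q) eps <= (1 + 3/4 q) eps.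
       Rounding then brings the bound to at least 2 eps, where [euler_grid_far] takes over. *)
    assert (E1 : vnorm M (vsub (euler_end (u1 :: u2 :: r) z) (grid_end (u1 :: u2 :: r) z))
                 <= (1 + 3 / 4 * q) * eps + eps + INR n * eps).
    { cbn [euler_end grid_end]. subst n. apply euler_grid_far; auto 6 using next_inS.
      - intros; apply HU; simpl; auto.
      - nra.
      - apply next_dist; auto using next_inS.
        apply vnorm_le_sqr; [nra|]. rewrite <- vnorm_sqr.
        eapply Rle_trans; [apply Hexpand; auto using next_inS|].
        specialize (first u1 Hu1). pose proof (vnorm_pos M (vsub (euler_step u1 z) (next F tau rep u1 z))).
        nra. }
    (* After the first rounding d = 2 eps, and the flow reduces 4 eps^2 to (4 - 3 q) eps^2 <= ((2 -
       3/4 q) eps)^2. The terms in q cancel in the sum with [E1]. *)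
    assert (E2 : vnorm M (vsub (p (S (S n))) (grid_end (w1 :: w2 :: r') z))
                 <= (2 - 3 / 4 * q) * eps + eps + INR n * eps).
    { cbn [grid_end]. subst n. rewrite <- H0.
      apply (shadowed_grid r' (fun j => p (S (S j)))); auto using next_inS.
      - intros; apply HU'; simpl; auto.
      - apply shadowed_tail with (p := fun j => p (S j)) (u := w2).
        now apply shadowed_tail with w1.
      - nra.
      - apply next_dist; auto using next_inS.
        apply vnorm_le_sqr; [nra|]. rewrite <- vnorm_sqr.
        eapply Rle_trans.
        + apply (shadowed_head (fun j => p (S j)) w2 r') with (d := eps + eps);
            auto using next_inS.
          * now apply shadowed_tail with w1.
          * lra.
          * apply next_dist; auto. apply shadowed_head_le with (w2 :: r'); auto. lra.
        + nra. }
    rewrite !S_INR. lra.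
Qed.

End Patterns.

(** * The error estimate *)

Theorem theorem2 (M k : nat) (L sigma tau eps : R) (U : list mode) (f : vec -> vec)
  (Lu lam C : mode -> R) (K : nat) (rep : vec -> vec) (sel : nat -> vec -> mode)
  (yf y : vec) (Y : list mode -> R -> vec) :
  (1 <= M)%nat -> (1 <= k)%nat -> 0 < L -> 0 < sigma -> 0 < tau -> 0 < eps ->
  U <> nil ->
  (forall u, In u U -> 0 <= fst u <= 1 /\ 0 <= snd u <= 1) ->
  (forall u, In u U -> lipschitz_on_S M (fmode M L sigma f u) (Lu u)) ->
  (forall u, In u U -> is_osl_const M (fmode M L sigma f u) (lam u)) ->
  (forall u, In u U ->
     is_lub (fun r => exists w, inS M w /\ r = Lu u * vnorm M (fmode M L sigma f u w)) (C u)) ->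
  (forall u, In u U -> hypH eps (lam u) (C u) tau) ->
  (0 < K)%nat -> sqrt (INR M) / (2 * eps) <= INR K ->
  is_rep M K rep ->
  is_sel M K (fmode M L sigma f) tau rep U yf sel ->
  inS M yf -> inS M y ->
  (forall pi, In pi (patterns U k) ->
     is_exact_traj M (fmode M L sigma f) tau pi y (Y pi) /\
     forall t, 0 <= t <= INR k * tau -> inS M (Y pi t)) ->
  (forall pi z t, In pi (patterns U k) -> inS M z -> 0 <= t <= INR k * tau ->
     inS M (euler (fmode M L sigma f) tau pi t z)) ->
  let z := rep y in
  let vk := lmin (map (fun pi => vnorm M (vsub (Y pi (INR k * tau)) yf)) (patterns U k)) in
  Rabs (vnorm M (vsub (euler (fmode M L sigma f) tau
                          (pidp (fmode M L sigma f) tau rep sel k z) (INR k * tau) z) yf)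
        - vk) <= (2 * INR k + 1) * eps.
Proof.
  intros HM Hk HL Hsig Htau Heps HU _ Hlip Hosl HC HH HK HMK Hrep Hsel Hyf Hy HY HEul z vk.
  set (F := fmode M L sigma f) in *.
  assert (Hu0 : exists u0, In u0 U) by (destruct U as [|u0 ?]; [easy|exists u0; now left]).
  destruct Hu0 as [u0 Hu0].
  (* Each constant is the smallest one, and a bound for one mode is a bound for all, so minimality
     applies in both directions. *)
  assert (Hlam : forall u, In u U -> lam u = lam u0).
  { intros u Hu. destruct (Hosl u Hu) as [H1 H2]. destruct (Hosl u0 Hu0) as [H3 H4].
    apply Rle_antisym; [apply H2|apply H4]; eapply osl_fmode_indep; eassumption. }
  set (m := - lam u0).
  assert (Hm : 0 < m) by (destruct (HH u0 Hu0) as [H _]; unfold m; lra).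
  assert (Hosl' : forall u, In u U -> osl_on_S M (F u) (- m)).
  { intros u Hu. unfold m. rewrite Ropp_involutive, <- (Hlam u Hu). now apply Hosl. }
  assert (HC' : forall u, In u U -> forall w, inS M w -> Lu u * vnorm M (F u w) <= C u).
  { intros u Hu w Hw. apply (HC u Hu). now exists w. }
  assert (Hsmall : forall u, In u U ->
    (tau * C u) ^ 2 <= 3 * eps ^ 2 * m ^ 2 * (1 - m * tau / 2)).
  { intros u Hu. pose proof (hypH_square _ _ _ _ Heps Htau (HH u Hu)) as H.
    rewrite (Hlam u Hu) in H. unfold m.
    replace (3 * eps ^ 2 * (- lam u0) ^ 2 * (1 - - lam u0 * tau / 2))
      with (3 * eps ^ 2 * lam u0 ^ 2 * (1 + lam u0 * tau / 2)) by field. exact H. }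
  set (q := m * tau * (1 - m * tau / 2)).
  assert (Hq : 0 <= q <= 1 / 2)
    by (now apply q_bounds with (C := C u0) (eps := eps); auto).
  assert (HkT : tau <= INR k * tau).
  { assert (1 <= INR k) by (now apply (le_INR 1)). nra. }
  (* Invariance of S is assumed for patterns of length k only: u is repeated k times and the first
     step is read off. *)
  assert (Hpart : forall u w s, In u U -> inS M w -> 0 <= s <= tau ->
    inS M (vadd w (vscal s (F u w)))).
  { intros u w s Hu Hw Hs. destruct k as [|k']; [lia|].
    assert (Hin : In (u :: repeat u k') (patterns U (S k'))).
    { apply patterns_spec. split; [simpl; now rewrite repeat_length|].
      intros x [<-|Hx]; [exact Hu|]. apply repeat_spec in Hx. now subst x. }
    pose proof (HEul _ w s Hin Hw ltac:(lra)) as H. cbn [euler] in H.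
    destruct (Rle_dec s tau); [exact H|lra]. }
  assert (Hstep : forall u w, In u U -> inS M w -> inS M (euler_step F tau u w)).
  { intros. apply Hpart; auto. lra. }
  assert (Hround : forall w, inS M w -> vnorm M (vsub w (rep w)) <= eps)
    by (intros; now apply rep_dist with K).
  assert (Hz : is_center M K z) by now apply Hrep.
  assert (HzS : inS M z) by now apply center_inS with K.
  assert (Hsh : forall pi, In pi (patterns U k) ->
    shadowed M F tau eps q (fun j => Y pi (INR j * tau)) pi
    /\ vnorm M (vsub (Y pi (INR 0 * tau)) z) <= eps).
  { intros pi Hpi. destruct (HY pi Hpi) as [(H0 & Hcont & Hder) HS].
    apply patterns_spec in Hpi. destruct Hpi as [Hl Hpi]. rewrite Hl in *.
    split.
    - intros j Hj a d Ha Hed Hd. rewrite Hl in Hj.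
      set (u := nth j pi (0, 0)).
      assert (Hu : In u U) by (apply Hpi, nth_In; lia).
      assert (Hj1 : INR (S j) * tau <= INR k * tau).
      { apply Rmult_le_compat_r; [lra|]. apply le_INR. lia. }
      assert (Hj0 : 0 <= INR j * tau) by (apply Rmult_le_pos; [apply pos_INR|lra]).
      assert (Hj2 : INR (S j) * tau = INR j * tau + tau) by (rewrite S_INR; ring).
      rewrite Hj2 in *.
      apply (flow_step M (F u) (Lu u) (C u) m tau eps); auto.
      + intros i Hi t Ht e He.
        destruct (Hcont i Hi t ltac:(lra) e He) as [r [Hr Hr']].
        exists r. split; [exact Hr|]. intros s Hs. apply Hr'. lra.
      + intros t Ht i Hi. apply Hder; [exact Hj|lra|exact Hi].
      + intros t Ht. apply HS. lra.
    - rewrite Rmult_0_l.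
      rewrite (vnorm_ext M _ (vsub y (rep y))); [now apply Hround|].
      intros i Hi. unfold vsub. now rewrite H0. }
  set (pe := pidp F tau rep sel k z).
  assert (Hpe : In pe (patterns U k)) by (eapply pidp_in_patterns; eassumption).
  destruct (Hsh pe Hpe) as [Hpe1 Hpe2].
  pose proof (proj1 (patterns_spec _ _ _) Hpe) as [Hle HUe].
  replace (euler F tau pe (INR k * tau) z) with (euler_end F tau pe z)
    by (rewrite <- Hle; symmetry; now apply euler_at_end).
  set (val := fun pi => vnorm M (vsub (Y pi (INR k * tau)) yf)) in *.
  assert (Hvk : In vk (map val (patterns U k))).
  { apply lmin_in. intros H. apply map_eq_nil in H. now rewrite H in Hpe. }
  apply in_map_iff in Hvk. destruct Hvk as (ps & Hvk & Hps).
  destruct (Hsh ps Hps) as [Hps1 Hps2].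
  pose proof (proj1 (patterns_spec _ _ _) Hps) as [Hls HUs].
  apply Rabs_le. split.
  (* Lower bound: the exact trajectory of [pe] competes in [vk] and ends within eps of its Euler
     image. *)
  - assert (H1 : vk <= val pe) by (apply lmin_le; now apply in_map).
    pose proof (vdist_tri M (Y pe (INR k * tau)) (euler_end F tau pe z) yf) as H2.
    pose proof (shadowed_euler M F tau U Hstep eps q Heps Hq pe _ z HUe Hpe1 HzS Hpe2) as H3.
    cbv beta in H3. rewrite Hle in H3. unfold val in H1.
    assert (0 <= INR k * eps) by (apply Rmult_le_pos; [apply pos_INR|lra]). lra.
  (* Upper bound: from the Euler image of [pe] to its grid end, then by optimality to the grid end
     of the exact minimiser [ps], then to the exact trajectory of [ps]. *)
  - pose proof (vdist_tri M (euler_end F tau pe z) (grid_end F tau rep pe z) yf) as H1.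
    pose proof (grid_pidp M K F tau rep U yf sel Hrep Hstep Hsel k z Hz) as H2. fold pe in H2.
    pose proof (vdp_le_grid M F tau rep U yf ps z HUs) as H3. rewrite Hls in H3.
    pose proof (vdist_tri M (grid_end F tau rep ps z) (Y ps (INR k * tau)) yf) as H4.
    rewrite (vdist_sym M (grid_end F tau rep ps z) (Y ps _)) in H4.
    assert (H5 : vnorm M (vsub (euler_end F tau pe z) (grid_end F tau rep pe z))
      + vnorm M (vsub (Y ps (INR k * tau)) (grid_end F tau rep ps z)) <= (2 * INR k + 1) * eps).
    { apply (euler_vs_grid_vs_exact M K F tau rep U Hrep Hstep eps q Heps Hq Hround)
        with (p := fun j => Y ps (INR j * tau)); auto.
      - intros u a b Hu Ha Hb.
        apply (euler_step_expansion M (F u) (Lu u) (C u)); auto.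
      - intros u a b D Hu Ha Hb HD Hd.
        apply (euler_step_nonexpansive M (F u) (Lu u) (C u) m tau eps); auto. }
    unfold val in Hvk. lra.
Qed.
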